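(* Assume that, for each $v\in\{0,1\}$, the intersection of $\{x:U(x,v)=0\}$ with the invariant set of $F_v$ contains only the origin. Let $\{V^i(\cdot,\cdot)\}_{i\ge0}$ be generated by stabilizing action dependent value iteration and let $v^i(x)=\operatorname*{arg\,min}_{w\in\{0,1\}}V^i(x,w)$. If the system is operated using the triggering policy $v^k(\cdot)$ at time $k$, i.e. according to the time-varying system $$x_{k+1}=F_{v^k(x_k)}(x_k),\quad k=0,1,2,\dots,$$ then the origin is asymptotically stable, and every trajectory contained in $\Omega$ converges to the origin.
   Context: Setting. A plant $x_{k+1}=f(x_k,u_k)$ has $f:\mathbb{R}^n\times\mathbb{R}^m\to\mathbb{R}^n$ continuous, $f(0,0)=0$, and a continuous control policy $h:\mathbb{R}^n\to\mathbb{R}^m$ is given, admissible in the sense that $h(0)=0$, $h$ asymptotically stabilizes $x_{k+1}=f(x_k,h(x_k))$ within the compact set $\Omega$, and $V_h(x_0):=\sum_{k=0}^\infty U(x_k^h,0)$ is continuous in $\Omega$, where $x_0^h=x_0$, $x_k^h=f(x_{k-1}^h,h(x_{k-1}^h))$. The switched system is $x_{k+1}=F_{v_k}(x_k)$, $v_k\in\{0,1\}$, with $F_0(x)=f(x,0)$ (network not used) and $F_1(x)=f(x,h(x))$ (network used). The infinite-horizon cost is $J=\sum_{k=0}^\infty U(x_k,v_k)$, where $U:\mathbb{R}^n\times\{0,1\}\to\mathbb{R}^+$ ($\mathbb{R}^+$ denotes the non-negative reals) is positive semi-definite and continuous in its first argument. Meaning of the invariant-set assumption: there is no set of states other than $\{0\}$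 in which a trajectory can stay forever with zero running cost, i.e. without converging to the origin. A triggering policy is a map $w(\cdot)$ from states to $\{0,1\}$. Its action dependent value function is $V_w(x_0,v):=U(x_0,v)+\sum_{k=1}^\infty U(x_k^w,w(x_k^w))$, where $x_1^w:=F_v(x_0)$ and $x_k^w:=F_{w(x_{k-1}^w)}(x_{k-1}^w)$ for $k\ge2$. It is admissible if $V_w(\cdot,v)$ is continuous (hence bounded) in the compact set $\Omega$ for every $v\in\{0,1\}$. Stabilizing action dependent value iteration is the recursion $$V^{i+1}(x,v)=U(x,v)+\min_{w'\in\{0,1\}}V^i\big(F_v(x),w'\big),\quad\forall x,\ \forall v\in\{0,1\},$$ initiated with $V^0=V_w$, the action dependent value function of an admissible triggering policy $w(\cdot)$.
   Formalization: The invariant-set assumption is imposed on zero-cost motions of the switched system (the mode v may vary along the motion), not for each F_v separately, for which the claim fails when arg min ties occur; Ω is also assumed to be a neighbourhood of the origin. *)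

(* Defs.v *)
From HB Require Import structures.
From mathcomp Require Import all_boot all_order all_algebra.
From mathcomp Require Import all_classical all_reals all_analysis.
Set Implicit Arguments.
Unset Strict Implicit.
Unset Printing Implicit Defensive.
Import Order.TTheory GRing.Theory Num.Theory.
Import numFieldNormedType.Exports.
Local Open Scope classical_set_scope.
Local Open Scope ring_scope.

Section TimeVarying.
Context {R : realType} {n : nat}.
Implicit Types (G : nat -> 'rV[R]_n -> 'rV[R]_n) (x : nat -> 'rV[R]_n).

(* [x k] is the state at time [k0 + k], [k0] being the initial time. *)
Definition solution G k0 x := forall k, x k.+1 = G (k0 + k)%N (x k).

(* Stability and attractivity are required from every initial time, with
   [delta] allowed to depend on it, as usual for time-varying systems; the
   norm of ['rV[R]_n] is the sup norm. *)
Definition stable G := forall k0 (eps : R), 0 < eps ->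
  exists2 delta : R, 0 < delta &
    forall x, solution G k0 x -> `|x 0%N| < delta -> forall k, `|x k| < eps.

Definition attractive G := forall k0,
  exists2 delta : R, 0 < delta &
    forall x, solution G k0 x -> `|x 0%N| < delta -> x @ \oo --> (0 : 'rV[R]_n).

Definition asymptotically_stable G := stable G /\ attractive G.

End TimeVarying.

Section Triggering.
Context {R : realType} {n m : nat}.
Variables (f : 'rV[R]_n -> 'rV[R]_m -> 'rV[R]_n) (h : 'rV[R]_n -> 'rV[R]_m).
Variables (U : 'rV[R]_n -> bool -> R) (Omega : set 'rV[R]_n).
Implicit Types (x y : 'rV[R]_n) (v : bool) (w : 'rV[R]_n -> bool).

(* The mode 1 (network used) is [true], the mode 0 is [false]. *)
Definition mode v x := if v then f x (h x) else f x 0.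

Definition finite_continuous_on (A : set 'rV[R]_n) (g : 'rV[R]_n -> \bar R) :=
  (forall x, A x -> g x \is a fin_num) /\ {within A, continuous g}.

(* Values live in [\bar R] because the series of nonnegative costs may
   diverge at states outside [Omega]. *)
Definition control_value x : \bar R :=
  (\sum_(0 <= k <oo) (U (iter k (mode true) x) false)%:E)%E.

Definition admissible_control :=
  [/\ h 0 = 0,
      stable (fun=> mode true),
      forall x, Omega x -> iter k (mode true) x @[k --> \oo] --> (0 : 'rV[R]_n)
    & finite_continuous_on Omega control_value].

Definition triggered w x := mode (w x) x.

Definition policy_value w x v : \bar R :=
  ((U x v)%:E +
   \sum_(1 <= k <oo)
     let xk := iter k.-1 (triggered w) (mode v x) in (U xk (w xk))%:E)%E.

Definition admissible_trigger w :=
  forall v, finite_continuous_on Omega (policy_value w ^~ v).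

Fixpoint value_iteration (V0 : 'rV[R]_n -> bool -> \bar R) (i : nat) x v
    : \bar R :=
  if i is j.+1 then
    ((U x v)%:E + Order.min (value_iteration V0 j (mode v x) false)
                            (value_iteration V0 j (mode v x) true))%E
  else V0 x v.

(* Invariance, in LaSalle's two-sided sense (F(S) = S for a single map F), of
   a set of states under the zero-cost motions of the switched system.
   The mode may change along a motion; the sets S on which U(., v) = 0 and
   F_v(S) = S for one fixed v are particular cases. *)
Definition zero_cost_invariant (S : set 'rV[R]_n) := forall x, S x ->
  (exists2 v, U x v = 0 & S (mode v x)) /\
  (exists y v, [/\ S y, U y v = 0 & mode v y = x]).

End Triggering.

(* Main.v *)
Require Import Defs.
From HB Require Import structures.
From mathcomp Require Import all_boot all_order all_algebra.
From mathcomp Require Import all_classical all_reals all_analysis.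
Import Order.TTheory GRing.Theory Num.Theory.
Import numFieldNormedType.Exports.
Local Open Scope classical_set_scope.
Local Open Scope ring_scope.

(* Along a motion of the system started at time k0, W^i(x) = min_w V^i(x, w)
   evaluated at i = k0 + k decreases by at least the running cost, so the total
   cost is at most V_w(x_0, .).  It is finite if x_0 lies in Omega, and tends to
   0 with x_0.  Limits of time-shifted motions whose running costs vanish are
   two-sided zero-cost motions, which the hypothesis reduces to the origin.
   Shifting a single motion contained in Omega gives its convergence; shifting
   a sequence of motions with x_0 -> 0 to their exit times from a small ball
   shows that such exits cannot exist, which is stability.  The two-sidedness
   is essential: a lower bound of W^i away from the origin may fail, since
   one-sided zero-cost motions are not excluded. *)

(** * Limits along ultrafilters *)

(** If the preimage of a neighborhood [A] is not in [F], the restriction of [F] to its complement is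
    proper; an ultrafilter refining it would contain both sets. *)
Lemma cvg_ultraP {I : Type} {T : topologicalType} (F : set_system I)
    (u : I -> T) (l : T) : Filter F ->
  (forall G, UltraFilter G -> F `<=` G -> u @ G --> l) -> u @ F --> l.
Proof.
move=> FF uG A lA; apply: contrapT => nFA.
have PF : ProperFilter (within (~` (u @^-1` A)) F).
  apply: Build_ProperFilter => F0; apply: nFA.
  apply: (@filterS _ F _ _ _ _ F0) => i nAi.
  exact: contrapT.
have [G [GU FG]] := ultraFilterLemma PF.
have GA : G (u @^-1` A).
  by apply: (uG G GU _ A lA) => B FB; apply: FG; apply: filterS FB.
have GnA : G (~` (u @^-1` A)) by apply: FG; exact: (@filterE _ F).
by have [i []] := filter_ex (filterI GA GnA).
Qed.

(** A cluster point of an ultrafilter is a limit: otherwise the complement of one of its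
    neighborhoods would belong to the ultrafilter. *)
Lemma ultra_compact_cvg {I : Type} {T : topologicalType} (G : set_system I)
    (u : I -> T) (K : set T) : UltraFilter G -> compact K ->
  G (u @^-1` K) -> exists2 y, K y & u @ G --> y.
Proof.
move=> GU Kco GK; have [y [Ky cly]] := Kco (u @ G) _ GK.
exists y => // A yA.
have [//|GnA] := in_ultra_setVsetC (u @^-1` A) GU.
by have [z []] := cly (~` A) A GnA yA.
Qed.

(** Makes the active mode constant along an ultrafilter, so that the continuity of one mode suffices
    to pass to the limit. *)
Lemma ultra_bool {I : Type} (G : set_system I) (b : I -> bool) :
  UltraFilter G -> exists c, \forall i \near G, b i = c.
Proof.
move=> GU; have [Gb|Gb] := in_ultra_setVsetC [set i | b i] GU.
  by exists true.
by exists false; apply: filterS Gb => i /negP/negbTE.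
Qed.

Lemma continuous_graph {X Y Z : topologicalType} (f : X -> Y -> Z)
    (g : X -> Y) :
  continuous (fun p : X * Y => f p.1 p.2) -> continuous g ->
  continuous (fun x => f x (g x)).
Proof.
move=> fc gc x; apply: (@continuous2_cvg _ _ _ _ (nbhs x) _ id g f).
- exact: (fc (x, g x)).
- exact: cvg_id.
- exact: gc.
Qed.

Lemma nbhs0_ball {R : realType} {n : nat} {A : set 'rV[R]_n} :
  nbhs (0 : 'rV[R]_n) A ->
  exists2 r : R, 0 < r & forall y : 'rV[R]_n, `|y| < r -> A y.
Proof.
move=> A0; have /nbhs_normP[r /= r_gt0 rA] := A0; exists r => // y yr.
by apply: rA; rewrite /ball_ /= sub0r normrN.
Qed.

(** * Motions of the switched system *)

Section SwitchedSystem.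
Context {R : realType} {n m : nat}.
Context {f : 'rV[R]_n -> 'rV[R]_m -> 'rV[R]_n} {h : 'rV[R]_n -> 'rV[R]_m}.
Context {U : 'rV[R]_n -> bool -> R}.

Lemma mode_continuous (b : bool) :
  continuous (fun p : 'rV[R]_n * 'rV[R]_m => f p.1 p.2) -> continuous h ->
  continuous (mode f h b).
Proof.
move=> fc hc; case: b.
  exact: (@continuous_graph 'rV[R]_n 'rV[R]_m 'rV[R]_n f h fc hc).
apply: (@continuous_graph 'rV[R]_n 'rV[R]_m 'rV[R]_n f (fun=> 0) fc) => x.
exact: cst_continuous.
Qed.

(* The states [s j (t j + p - q)], observed at a fixed offset [p - q] from
   [t j], have limits along every ultrafilter finer than [\oo]: those with
   [p - q <= 0] by compactness, the later ones by continuity of the modes.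
   These limits form a two-sided zero-cost motion, hence vanish.  For [j]
   large, [q <= t j] and the subtraction is not truncated. *)
Lemma zero_cost_limit (K : set 'rV[R]_n) (s : nat -> nat -> 'rV[R]_n)
    (b : nat -> nat -> bool) (t : nat -> nat) :
  (forall c, continuous (mode f h c)) ->
  (forall c, continuous (fun x => U x c)) ->
  (forall S : set 'rV[R]_n, zero_cost_invariant f h U S -> S `<=` [set 0]) ->
  compact K ->
  (forall j k, s j k.+1 = mode f h (b j k) (s j k)) ->
  (forall j k, (k <= t j)%N -> K (s j k)) ->
  t @ \oo --> \oo ->
  (forall p q, U (s j (t j + p - q)%N) (b j (t j + p - q)%N) @[j --> \oo]
     --> (0 : R)) ->
  s j (t j).+1 @[j --> \oo] --> (0 : 'rV[R]_n).
Proof.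
move=> Fc Uc zero Kco sS sK too cost0.
apply: cvg_ultraP => G GU ooG.
pose y p q := fun j => s j (t j + p - q)%N.
have tge q : \forall j \near G, (q <= t j)%N.
  by apply: ooG; exact: (too _ (nbhs_infty_ge q)).
have step p q (z : 'rV[R]_n) : y p q @ G --> z ->
    exists2 c, U z c = 0 & y p.+1 q @ G --> mode f h c z.
  move=> yz; have [c bc] := ultra_bool G (fun j => b j (t j + p - q)%N) GU.
  exists c.
    have U0 : U (y p q j) c @[j --> G] --> (0 : R).
      apply: cvg_trans (cvg_trans _ (cost0 p q)).
        2: by move=> A; exact: ooG.
      by apply: near_eq_cvg; apply: filterS bc => j <-.
    have Uz : U (y p q j) c @[j --> G] --> U z c.
      exact: (cvg_comp _ _ yz (Uc c z)).
    exact: (cvg_unique _ Uz U0).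
  have Fz : mode f h c (y p q j) @[j --> G] --> mode f h c z.
    exact: (cvg_comp _ _ yz (Fc c z)).
  apply: cvg_trans Fz; apply: near_eq_cvg.
  near=> j; rewrite /y addnS subSn; last first.
    by rewrite (leq_trans _ (leq_addr _ _))//; near: j; exact: tge.
  by rewrite sS; congr (mode _ _ _ _); near: j; apply: filterS bc.
have lim p q : exists z : 'rV[R]_n, y p q @ G --> z.
  elim: p => [|p [z yz]]; last first.
    by have [c _ yc] := step _ _ _ yz; exists (mode f h c z).
  have [|z _ yz] := @ultra_compact_cvg _ _ G (y 0 q) K GU Kco; last by exists z.
  by apply: filterS filterT => j _; apply: sK; rewrite addn0 leq_subr.
have S0 := zero [set z : 'rV[R]_n | exists p q, y p q @ G --> z].
have [z yz] := lim 1%N 0%N.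
suff z0 : z = 0.
  move: yz; rewrite z0 /y.
  by under eq_fun do rewrite subn0 addn1.
apply: S0; last by exists 1%N, 0%N.
move=> {yz}{}z [p [q yz]]; split.
  have [c Uz yc] := step _ _ _ yz.
  by exists c => //; exists p.+1, q.
(* A predecessor of [z] is the limit at the offset one lower, obtained by raising [q]. *)
have [z' yz'] := lim p q.+1.
have [c Uz' yc] := step _ _ _ yz'.
exists z', c; split => //; first by exists p, q.+1.
have yE : y p.+1 q.+1 = y p q by apply/funext => j; rewrite /y addnS subSS.
by move: yc; rewrite yE => yc; exact: (cvg_unique _ yc yz).
Unshelve. all: by end_near. Qed.

(** The neighborhood is uniform in the sequence of modes: each step intersects the preimages under
    only two maps fixing the origin. *)
Lemma near0_motion (A : set 'rV[R]_n) (N : nat) :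
  (forall c, continuous (mode f h c)) -> (forall c, mode f h c 0 = 0) ->
  nbhs (0 : 'rV[R]_n) A ->
  \forall y \near (0 : 'rV[R]_n),
    forall (s : nat -> 'rV[R]_n) (b : nat -> bool), s 0%N = y ->
    (forall k, s k.+1 = mode f h (b k) (s k)) ->
    forall k, (k <= N)%N -> A (s k).
Proof.
move=> Fc F0 A0; elim: N => [|N IH].
  by apply: filterS A0 => y Ay s b s0 _ k; rewrite leqn0 => /eqP ->; rewrite s0.
have IHF c : \forall y \near (0 : 'rV[R]_n),
    forall (s : nat -> 'rV[R]_n) (b : nat -> bool), s 0%N = mode f h c y ->
    (forall k, s k.+1 = mode f h (b k) (s k)) ->
    forall k, (k <= N)%N -> A (s k).
  have := Fc c 0; rewrite /continuous_at F0 => Fc0; exact: (Fc0 _ IH).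
apply: filterS (filterI A0 (filterI (IHF true) (IHF false))) => y.
move=> [Ay [IHt IHf]] s b s0 sS [_|k kN]; first by rewrite s0.
have := sS 0%N; rewrite s0; case: (b 0%N) => s1.
- exact: (IHt (s \o S) (b \o S) s1 (fun i => sS i.+1) k kN).
- exact: (IHf (s \o S) (b \o S) s1 (fun i => sS i.+1) k kN).
Qed.

(** * Monotonicity of value iteration and cost bounds *)

Section Values.
Hypothesis U_ge0 : forall x b, 0 <= U x b.

(** Bellman equation of a fixed policy: the first term of the series is split off and the rest
    reindexed along the motion. *)
Lemma policy_value_step w x c :
  policy_value f h U w x c =
  ((U x c)%:E +
   policy_value f h U w (mode f h c x) (w (mode f h c x)))%E.
Proof.
rewrite /policy_value; congr (_ + _)%E.
set y := mode f h c x; pose T := triggered f h w.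
pose g k := (U (iter k T y) (w (iter k T y)))%:E.
have g0 k : (0 <= g k)%E by rewrite lee_fin.
rewrite -(@nneseries_addn R (fun k => g k.-1) 1) //.
rewrite [LHS](_ : _ = \sum_(0 <= k <oo) g k)%E; last first.
  by apply: eq_eseriesr => k _; rewrite addn1.
rewrite (nneseries_recl (P := xpredT)) //; congr (_ + _)%E.
rewrite -(@nneseries_addn R g 1) //.
pose g' k := (U (iter k.-1 T (T y)) (w (iter k.-1 T (T y))))%:E.
rewrite -(@nneseries_addn R g' 1); last by move=> k; rewrite lee_fin.
by apply: eq_eseriesr => k _; rewrite addn1 /g /g' iterSr.
Qed.

Lemma policy_value_ge0 w x c : (0 <= policy_value f h U w x c)%E.
Proof.
rewrite adde_ge0 ?lee_fin//; apply: nneseries_ge0 => k _ _.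
by rewrite lee_fin.
Qed.

Lemma policy_value0 w c :
  (forall b, U 0 b = 0) -> (forall b, mode f h b 0 = 0) ->
  policy_value f h U w 0 c = 0%E.
Proof.
move=> U0 F0; rewrite /policy_value U0 add0e; apply: eseries0 => k _ _ /=.
rewrite F0.
have -> : iter k.-1 (triggered f h w) 0 = 0; last by rewrite U0.
by elim: k.-1 => //= i ->; rewrite /triggered F0.
Qed.

Let V w := value_iteration f h U (policy_value f h U w).

Lemma value_iteration_ge0 w i x c : (0 <= V w i x c)%E.
Proof.
elim: i x c => [|i IH] x c; first exact: policy_value_ge0.
by rewrite /= adde_ge0 ?lee_fin// le_min !IH.
Qed.

Lemma value_iteration_step_le w i x c b :
  (V w i.+1 x c <= (U x c)%:E + V w i (mode f h c x) b)%E.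
Proof. by rewrite /= leeD2l// ge_min; case: b; rewrite lexx ?orbT. Qed.

(** The first iterate improves on the policy because the minimum is at most the value at the choice
    of [w]; monotonicity of the recursion propagates this. *)
Lemma value_iterationS_le w i x c : (V w i.+1 x c <= V w i x c)%E.
Proof.
elim: i x c => [|i IH] x c.
  rewrite [leRHS]policy_value_step; exact: value_iteration_step_le.
by rewrite [leRHS]/= leeD2l// le_min !ge_min !IH orbT.
Qed.

Lemma value_iteration_le_policy w i x c :
  (V w i x c <= policy_value f h U w x c)%E.
Proof.
by elim: i => [|i]; [exact: lexx|exact/le_trans/value_iterationS_le].
Qed.

Section GreedyPolicy.
Variables (w : 'rV[R]_n -> bool) (v : nat -> 'rV[R]_n -> bool).
Hypothesis v_argmin : forall i x b, (V w i x (v i x) <= V w i x b)%E.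
Variables (k0 : nat) (x : nat -> 'rV[R]_n).
Hypothesis x_sol : solution (fun k x => mode f h (v k x) x) k0 x.

(* [V i x (v i x)] is a Lyapunov function: it decreases along the motion by at
   least the running cost. *)
Lemma greedy_value_decrease k :
  ((U (x k) (v (k0 + k)%N (x k)))%:E +
   V w (k0 + k.+1) (x k.+1) (v (k0 + k.+1)%N (x k.+1))
   <= V w (k0 + k) (x k) (v (k0 + k)%N (x k)))%E.
Proof.
have V_le b : (V w (k0 + k.+1) (x k.+1) (v (k0 + k.+1)%N (x k.+1))
    <= V w (k0 + k) (x k.+1) b)%E.
  apply: le_trans (value_iterationS_le w (k0 + k) _ b).
  by rewrite -addnS; exact: v_argmin.
(* Raising the index at [x k] exposes the minimum of the recursion over the iterate [k0 + k] at
   [x k.+1], which [V_le] bounds from below. *)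
apply: le_trans (value_iterationS_le _ _ _ _).
rewrite /V /= -(x_sol k) leeD2l// le_min.
by apply/andP; split; exact: V_le.
Qed.

Lemma greedy_cost_le k b :
  ((\sum_(i < k) U (x i) (v (k0 + i)%N (x i)))%:E
   <= policy_value f h U w (x 0%N) b)%E.
Proof.
apply: le_trans (value_iteration_le_policy w k0 (x 0%N) b).
apply: le_trans (v_argmin _ _ _).
suff : ((\sum_(i < k) U (x i) (v (k0 + i)%N (x i)))%:E +
   V w (k0 + k) (x k) (v (k0 + k)%N (x k))
   <= V w k0 (x 0%N) (v k0 (x 0%N)))%E.
  by apply: le_trans; rewrite leeDl// value_iteration_ge0.
elim: k => [|k IH]; first by rewrite big_ord0 add0e addn0.
apply: le_trans IH; rewrite big_ord_recr/= EFinD -addeA leeD2l//.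
exact: greedy_value_decrease.
Qed.

Lemma greedy_cost_le1 k b :
  ((U (x k) (v (k0 + k)%N (x k)))%:E <= policy_value f h U w (x 0%N) b)%E.
Proof.
apply: le_trans (greedy_cost_le k.+1 b).
by rewrite lee_fin big_ord_recr/= lerDr sumr_ge0.
Qed.

Lemma greedy_cost_cvg0 b : policy_value f h U w (x 0%N) b \is a fin_num ->
  U (x k) (v (k0 + k)%N (x k)) @[k --> \oo] --> (0 : R).
Proof.
move=> finV; apply: cvg_series_cvg_0; apply: nondecreasing_is_cvgn.
  by apply: nondecreasing_series => *; exact: U_ge0.
exists (fine (policy_value f h U w (x 0%N) b)) => _ [k _ <-].
by rewrite -lee_fin fineK// seriesEord greedy_cost_le.
Qed.

End GreedyPolicy.
End Values.
End SwitchedSystem.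

(** * Convergence and stability *)

Theorem theorem6 (R : realType) (n m : nat)
  (f : 'rV[R]_n -> 'rV[R]_m -> 'rV[R]_n) (h : 'rV[R]_n -> 'rV[R]_m)
  (U : 'rV[R]_n -> bool -> R) (Omega : set 'rV[R]_n)
  (w : 'rV[R]_n -> bool) (v : nat -> 'rV[R]_n -> bool)
  (f_cont : continuous (fun p : 'rV[R]_n * 'rV[R]_m => f p.1 p.2))
  (f0 : f 0 0 = 0)
  (h_cont : continuous h)
  (U_ge0 : forall x b, 0 <= U x b)
  (U0 : forall b, U 0 b = 0)
  (U_cont : forall b, continuous (fun x => U x b))
  (Omega_compact : compact Omega)
  (Omega_nbhs0 : nbhs (0 : 'rV[R]_n) Omega)
  (h_adm : admissible_control f h U Omega)
  (zero_cost : forall S : set 'rV[R]_n,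
     zero_cost_invariant f h U S -> S `<=` [set 0])
  (w_adm : admissible_trigger f h U Omega w)
  (v_argmin : forall i x b,
     let V := value_iteration f h U (policy_value f h U w) in
     (V i x (v i x) <= V i x b)%E) :
  let G := fun k x => mode f h (v k x) x in
  asymptotically_stable G /\
  (forall k0 (x : nat -> 'rV[R]_n), solution G k0 x ->
     (forall k, Omega (x k)) -> x @ \oo --> (0 : 'rV[R]_n)).
Proof.
move=> G; have [h0 _ _ _] := h_adm.
have Fc c : continuous (mode f h c) by exact: mode_continuous.
have F0 c : mode f h c 0 = 0 by case: c; rewrite /mode ?h0.
have conv k0 (x : nat -> 'rV[R]_n) : solution G k0 x ->
    (forall k, Omega (x k)) -> x @ \oo --> (0 : 'rV[R]_n).
  move=> xS xO; rewrite -cvg_shiftS /=.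
  (* A constant family of motions, observed around the time [j] itself. *)
  apply: (@zero_cost_limit _ _ _ f h U Omega (fun=> x)
    (fun _ k => v (k0 + k)%N (x k)) id) => //.
  move=> p q.
  have pq : (j + p - q)%N @[j --> \oo] --> \oo.
    exact: (cvg_comp _ _ (cvg_addnr p) (cvg_subnr q)).
  apply: (cvg_comp _ _ pq (greedy_cost_cvg0 U_ge0 w v v_argmin k0 x xS true _)).
  by have [+ _] := w_adm true; exact.
(* The origin is interior to [Omega], so continuity within [Omega] is continuity there. *)
have V_cvg0 : policy_value f h U w y true @[y --> (0 : 'rV[R]_n)] --> 0%E.
  have [_] := w_adm true.
  move=> /subspace_continuousP/(_ 0 (nbhs_singleton Omega_nbhs0)).
  by rewrite within_interior// -[in X in _ -> X](policy_value0 w true U0 F0).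
have [r r_gt0 rO] := nbhs0_ball Omega_nbhs0.
have G_stable : stable G.
  move=> k0 eps eps_gt0.
  (* The bound by [r] keeps a motion inside the compact [Omega] until it exits. *)
  pose e := Num.min eps r.
  have e_gt0 : 0 < e by rewrite lt_min eps_gt0.
  (* Otherwise there are motions [x] with [x 0] arbitrarily close to [0] which
     leave the ball of radius [e].  By continuity at [0] the exit times tend to
     [\oo] and the total costs to [0], so the exit states tend to [0]. *)
  apply: contrapT => no_delta.
  (* [xt.2] is the last time before the first exit; [harmonic] serves as a positive null
     sequence. *)
  pose P j (xt : (nat -> 'rV[R]_n) * nat) :=
    [/\ solution G k0 xt.1,
      (policy_value f h U w (xt.1 0%N) true <= (harmonic j)%:E)%E,
      (j <= xt.2)%N, forall k, (k <= xt.2)%N -> `|xt.1 k| < e &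
      e <= `|xt.1 xt.2.+1|].
  have /choice[xt xtP] j : exists xt, P j xt.
    have V_near : \forall y \near (0 : 'rV[R]_n),
        (policy_value f h U w y true <= (harmonic j)%:E)%E.
      have harm0 : (0 < (harmonic j)%:E :> \bar R)%E.
        by rewrite lte_fin harmonic_gt0.
      near=> y; apply/ltW; near: y.
      exact: (V_cvg0 _ (open_ereal_lt' harm0)).
    have ball0 := @nbhs0_lt R 'rV[R]_n e e_gt0.
    have [d d_gt0 dP] := nbhs0_ball
      (filterI V_near (near0_motion [set y | `|y| < e] j Fc F0 ball0)).
    apply: contrapT => noP; apply: no_delta; exists d => // x xS x0d.
    have [Vx0 near_x] := dP _ x0d.
    suff xe k : `|x k| < e.
      by move=> k; rewrite (lt_le_trans (xe k))// ge_min lexx.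
    apply: contrapT => /negP xke.
    have exk : exists k, ~~ (`|x k| < e) by exists k.
    case: (ex_minnP exk) => k1 xk1 k1_min; apply: noP.
    (* The choice of [d] keeps the motion in the ball up to time [j]; in particular the first exit
       time [k1] has a predecessor. *)
    have k1j : (j < k1)%N.
      rewrite ltnNge; apply/negP => k1j.
      move/negP: xk1; apply.
      exact: (near_x x (fun k => v (k0 + k)%N (x k)) erefl xS).
    case: k1 xk1 k1_min k1j => // t xk1 k1_min k1j.
    exists (x, t); split => //=; last by rewrite leNgt.
    move=> i it; apply: contrapT => /negP/k1_min.
    by rewrite ltnNge it.
  have lim0 : (xt j).1 (xt j).2.+1 @[j --> \oo] --> (0 : 'rV[R]_n).
    apply: (@zero_cost_limit _ _ _ f h U Omega (fun j => (xt j).1)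
      (fun j k => v (k0 + k)%N ((xt j).1 k)) (fun j => (xt j).2)) => //.
    - by move=> j k; have [xS _ _ _ _] := xtP j; exact: xS.
    - move=> j k kt; have [_ _ _ xe _] := xtP j; apply: rO.
      by rewrite (lt_le_trans (xe _ kt))// ge_min lexx orbT.
    - move=> A [N _ NA]; exists N => // j /= Nj; apply: NA => /=.
      by have [_ _ jt _ _] := xtP j; exact: leq_trans jt.
    move=> p q.
    (* A single running cost is at most the policy value at the initial state, whatever its time
       index. *)
    apply: (@squeeze_cvgr _ _ _ _ (fun=> 0) harmonic).
    - near=> j; rewrite U_ge0 /= -lee_fin.
      have [xS Vx _ _ _] := xtP j.
      exact: le_trans (greedy_cost_le1 U_ge0 w v v_argmin k0 _ xS _ true) Vx.
    - exact: cvg_cst.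
    - exact: cvg_harmonic.
  have [j] := filter_ex (cvgr0_norm_lt _ lim0 _ e_gt0).
  by have [_ _ _ _ ex] := xtP j; rewrite ltNge ex.
split=> //; split=> // k0.
(* Stability at radius [r] confines the motion to [Omega], where [conv] applies. *)
have [d d_gt0 dP] := G_stable k0 r r_gt0.
by exists d => // x xS x0d; apply: (conv k0 x xS) => k; apply: rO; exact: dP.
Unshelve. all: by end_near. Qed.
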